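(* Let $k$ be a commutative domain in which $2$ is invertible and let $n\geq 2$. Let $W_n$ be the $k$-algebra generated by $x_1,\dots,x_n$ subject to the relations $x_ix_j+x_jx_i=1$ for all $i\neq j$, and let $Z=k[x_1^2,\dots,x_n^2]\subseteq W_n$ (a central subalgebra). Let $M$ be the $n\times n$ matrix over $Z$ whose $i$-th diagonal entry is $2x_i^2$ and whose off-diagonal entries are all equal to $1$. Then the discriminant of $W_n$ over $Z$ is $$d(W_n/Z)=c\,(\det M)^{2^{n-1}},$$ where $c$ is an element of $k^{\times}$.
   Context: Discriminant: let $A$ be an algebra and $Z\subseteq A$ a central subalgebra such that $A$ is a free $Z$-module of finite rank $r$. Embed $A$ into $\mathrm{End}(A_Z)\cong M_{r\times r}(Z)$ by sending $a$ to left multiplication by $a$, and let $\mathrm{tr}:A\to Z$ be the composite with the usual matrix trace. If $\{z_1,\dots,z_r\}$ is a $Z$-basis of $A$, the discriminant is $d(A/Z)=\det(\mathrm{tr}(z_iz_j))_{r\times r}\in Z$; it is well defined up to multiplication by an element of $Z^{\times}$. The algebra $W_n$ is free over $Z$ with basis $\{x_1^{d_1}\cdots x_n^{d_n}\mid d_s\in\{0,1\}\}$. For a ring $R$, $R^{\times}$ denotes its group of invertible elements. *)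

(* Defs.v *)
From HB Require Import structures.
From mathcomp Require Import all_boot all_order all_algebra.
From mathcomp Require Import boolp classical_sets.
From mathcomp Require Import monalg.

Set Implicit Arguments.
Unset Strict Implicit.
Unset Printing Implicit Defensive.

Import GRing.Theory.
Local Open Scope ring_scope.
Local Open Scope quotient_scope.

(* [iota : Z -> A] is the inclusion of a central subalgebra; the coordinates
   of an element of [A] in a [Z]-basis [z] form a row vector over [Z]. *)
Section Discriminant.
Variables (Z : comNzRingType) (A : nzRingType) (iota : {rmorphism Z -> A}).
Variables (r : nat) (z : 'I_r -> A).

Definition lincomb (c : 'rV[Z]_r) : A := \sum_(i < r) iota (c 0 i) * z i.

Definition is_basis : Prop := forall a : A, exists! c : 'rV[Z]_r, lincomb c = a.

(* Meaningful only when [z] is a basis; [xget] then picks the unique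
   coordinate vector. *)
Definition coordinates (a : A) : 'rV[Z]_r :=
  xget 0 [set c | lincomb c = a]%classic.

Definition lmul_mx (a : A) : 'M[Z]_r :=
  \matrix_(i, j) coordinates (a * z j) 0 i.

Definition reg_trace (a : A) : Z := \tr (lmul_mx a).

Definition discriminant : Z :=
  \det (\matrix_(i < r, j < r) reg_trace (z i * z j)).

End Discriminant.

Section GeneratedSubalgebra.
Variables (k : comNzRingType) (A : algType k) (S : A -> Prop).

Inductive generated : A -> Prop :=
| generated_gen a : S a -> generated a
| generated_scalar (c : k) : generated c%:A
| generated_add a b : generated a -> generated b -> generated (a + b)
| generated_mul a b : generated a -> generated b -> generated (a * b).

Definition gen_subalg : {pred A} := fun a => `[< generated a >].

Fact gen_subalg_closed : subalg_closed gen_subalg.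
Proof.
split=> [|c a b|a b]; rewrite /in_mem /=.
- by rewrite -[1]scale1r; apply/asboolP; exact: generated_scalar.
- move=> /asboolP ga /asboolP gb; apply/asboolP; apply: generated_add => //.
  by rewrite -[a]mul1r scalerAl; apply: generated_mul => //;
    exact: generated_scalar.
- move=> /asboolP ga /asboolP gb; apply/asboolP; exact: generated_mul.
Qed.

HB.instance Definition _ := GRing.isSubalgClosed.Build k A gen_subalg
  (GRing.subalg_closed_semi gen_subalg_closed).

End GeneratedSubalgebra.

(* Scalars are central in the free algebra, for which monalg.v only provides a
   left algebra structure. *)
Lemma malg_scalerAr (K : monomType) (k : comNzRingType) (c : k)
    (p q : {malg k[K]}) : c *: (p * q) = p * (c *: q).
Proof.
rewrite -!mul_malgC !mulrA; congr (_ * q).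
rewrite [p]monalgE mulr_sumr mulr_suml; apply: eq_bigr => m _.
by rewrite ![LHS]fgmulUU ![RHS]fgmulUU mulrC mul1m mulm1.
Qed.

(* The k-algebra W_n with generators x_i and relations x_i x_j + x_j x_i = 1
   for i != j, as the quotient of the free algebra by the two-sided ideal
   [weyl_rel] generated by the relations. *)
Section QuantumWeyl.
Variables (k : comNzRingType) (n : nat).

Local Notation free_alg := {malg k[{fmonom 'I_n}]}.

Definition free_gen (i : 'I_n) : free_alg := << fmu i >>.

Inductive weyl_rel : free_alg -> Prop :=
| weyl_rel_gen (i j : 'I_n) : i != j ->
    weyl_rel (free_gen i * free_gen j + free_gen j * free_gen i - 1)
| weyl_rel_0 : weyl_rel 0
| weyl_rel_add p q : weyl_rel p -> weyl_rel q -> weyl_rel (p + q)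
| weyl_rel_mull p q : weyl_rel q -> weyl_rel (p * q)
| weyl_rel_mulr p q : weyl_rel p -> weyl_rel (p * q).

Definition weyl_ideal : {pred free_alg} := fun p => `[< weyl_rel p >].

Fact weyl_ideal_zmod_closed : zmod_closed weyl_ideal.
Proof.
split=> [|p q]; first by apply/asboolP; exact: weyl_rel_0.
move=> /asboolP rp /asboolP rq; apply/asboolP; apply: weyl_rel_add => //.
by rewrite -mulN1r; exact: weyl_rel_mull.
Qed.

HB.instance Definition _ :=
  GRing.isZmodClosed.Build free_alg weyl_ideal weyl_ideal_zmod_closed.

Definition qweyl : Type := Quotient.quot weyl_ideal.
HB.instance Definition _ := GRing.Zmodule.on qweyl.
HB.instance Definition _ := EqQuotient.on qweyl.

Local Notation W := qweyl.

Lemma qweyl_eqP (p q : free_alg) :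
  reflect (weyl_rel (p - q)) (\pi_W p == \pi_W q).
Proof. by rewrite eqmodE; exact: asboolP. Qed.

Lemma qweyl_repr (p : free_alg) : weyl_rel (repr (\pi_W p) - p).
Proof. by apply/qweyl_eqP; rewrite reprK. Qed.

Definition qweyl_one : W := lift_cst W 1.
Definition qweyl_mul : W -> W -> W := lift_op2 W *%R.
Definition qweyl_scale (c : k) : W -> W := lift_op1 W ( *:%R c).

Lemma pi_qweyl_one : \pi_W 1 = qweyl_one.
Proof. by unlock qweyl_one. Qed.

Lemma pi_qweyl0 : \pi_W 0 = 0.
Proof. exact: pi_zeror. Qed.

Lemma pi_qweylD p q : \pi_W (p + q) = \pi_W p + \pi_W q.
Proof. exact: Quotient.pi_add. Qed.

Lemma pi_qweylM p q : qweyl_mul (\pi_W p) (\pi_W q) = \pi_W (p * q).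
Proof.
unlock qweyl_mul; apply/eqP/qweyl_eqP.
set p' := repr _; set q' := repr _.
rewrite (_ : _ - _ = (p' - p) * q' + p * (q' - q)); last first.
  by rewrite mulrBl mulrBr addrA subrK.
apply: weyl_rel_add; last by apply: weyl_rel_mull; exact: qweyl_repr.
by apply: weyl_rel_mulr; exact: qweyl_repr.
Qed.

Lemma pi_qweylZ c p : qweyl_scale c (\pi_W p) = \pi_W (c *: p).
Proof.
unlock qweyl_scale; apply/eqP/qweyl_eqP; rewrite -scalerBr -[_ - _]mul1r scalerAl.
by apply: weyl_rel_mull; exact: qweyl_repr.
Qed.


(* The algebra is nontrivial because it acts on a fermionic Fock space: with
   creation and annihilation operators f_i, e_i, the operators
   f_i + \sum_(j < i) e_j satisfy the defining relations. Adding one mode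
   doubles the dimension, [s] being the sum of all annihilation operators. *)
Lemma fock_representation (m : nat) :
  exists N (y : nat -> 'M[k]_N.+1) (s : 'M[k]_N.+1),
    [/\ forall i j, (i < m)%N -> (j < m)%N -> i != j ->
          y i * y j + y j * y i = 1,
        forall i, (i < m)%N -> s * y i + y i * s = 1
      & s * s = 0].
Proof.
elim: m => [|m [N [y [s [yy sy ss]]]]].
  by exists 0, (fun=> 0), 0; split=> //; rewrite mul0r.
pose blk (a b c g : 'M[k]_N.+1) : 'M[k]_((N + N.+1).+1) :=
  @block_mx k N.+1 N.+1 N.+1 N.+1 a b c g.
have blk1 : blk 1 0 0 1 = 1 by apply/esym; exact: (@scalar_mx_block k N.+1 N.+1 1).
have blk0 : blk 0 0 0 0 = 0 by exact: (@block_mx0 k N.+1 N.+1 N.+1 N.+1).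
have blkM a b c g a' b' c' g' : blk a b c g * blk a' b' c' g' =
    blk (a * a' + b * c') (a * b' + b * g') (c * a' + g * c') (c * b' + g * g').
  exact: (@mulmx_block k N.+1 N.+1 N.+1 N.+1 N.+1 N.+1).
have blkD a b c g a' b' c' g' : blk a b c g + blk a' b' c' g' =
    blk (a + a') (b + b') (c + c') (g + g').
  exact: (@add_block_mx k N.+1 N.+1 N.+1 N.+1).
pose d b := blk b 0 0 (- b).
pose e := blk 0 1 0 0.
pose f := blk 0 0 1 0.
pose simpB := (mulr0, mul0r, mulr1, mul1r, addr0, add0r,
  mulrN, mulNr, opprK, subrr, addNr, oppr0).
have dd a b : d a * d b + d b * d a =
    blk (a * b + b * a) 0 0 (a * b + b * a).
  by rewrite /d !blkM blkD !simpB.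
have de a : d a * e + e * d a = 0.
  by rewrite /d /e !blkM blkD !simpB blk0.
have df a : d a * f + f * d a = 0.
  by rewrite /d /f !blkM blkD !simpB blk0.
have ed a : e * d a = - (d a * e).
  by apply/eqP; rewrite -addr_eq0 addrC de.
have fd a : f * d a = - (d a * f).
  by apply/eqP; rewrite -addr_eq0 addrC df.
have ef : e * f + f * e = 1.
  by rewrite /e /f !blkM blkD !simpB blk1.
have ee : e * e = 0.
  by rewrite /e !blkM !simpB blk0.
have d2 : d s * d s = 0 by rewrite /d !blkM !simpB ss blk0.
have Fd a b : (f + d a) * d b + d b * (f + d a) = d a * d b + d b * d a.
  by rewrite mulrDl mulrDr addrACA [f * _ + _]addrC df add0r.
have Ed a b : (e + d a) * d b + d b * (e + d a) = d a * d b + d b * d a.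
  by rewrite mulrDl mulrDr addrACA [e * _ + _]addrC de add0r.
exists (N + N.+1)%N, (fun i => if (i < m)%N then d (y i) else f + d s), (e + d s).
split=> [i j||]; last first.
- by rewrite mulrDl !mulrDr ee d2 addr0 add0r addrC de.
- move=> i _; case: ifP => [lt_im|_].
    by rewrite Ed dd sy // blk1.
  rewrite !mulrDl !mulrDr d2 !addr0 ed fd addrACA [_ - _ + _]addrACA ef.
  by rewrite -opprD [d s * f + _]addrC subrK.
rewrite !ltnS => le_im le_jm neq_ij.
case: ifP => lt_im; case: ifP => lt_jm.
- by rewrite dd yy // blk1.
- by rewrite addrC Fd dd sy // blk1.
- by rewrite Fd dd sy // blk1.
- have := neq_ij; rewrite (_ : i = j) ?eqxx //.
  have /eqP-> : i == m by rewrite eqn_leq le_im leqNgt lt_im.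
  by apply/esym/eqP; rewrite eqn_leq le_jm leqNgt lt_jm.
Qed.

Lemma weyl_rel_proper : ~ weyl_rel 1.
Proof.
have [N [y [_ [yy _ _]]]] := fock_representation n.
pose h (m : {fmonom 'I_n}) : 'M[k]_N.+1 := \prod_(i <- (m : seq 'I_n)) y i.
have hM : mmorphism h by split=> [p q|]; rewrite /h ?fmM ?big_cat ?fm1 ?big_nil.
pose hmm := isMultiplicative.Build _ _ h hM.
pose H : {mmorphism {fmonom 'I_n} -> 'M[k]_N.+1} := HB.pack h hmm.
pose phi : free_alg -> 'M[k]_N.+1 := mmap (@scalar_mx k N.+1) H.
have [phi1 phiM] : monoid_morphism phi.
  have [] // := @commr_mmap_is_multiplicative _ _ _ (@scalar_mx k N.+1) H.
  by move=> g m m'; exact: comm_scalar_mx.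
have phi0 : phi 0 = 0 by exact: mmap0.
have phiD p q : phi (p + q) = phi p + phi q by exact: mmapD.
have phiB p q : phi (p - q) = phi p - phi q by exact: mmapB.
have phiX i : phi (free_gen i) = y i.
  by rewrite /phi mmapU /= /h fmU big_seq1 mul1r.
have phiXX i j : phi (free_gen i * free_gen j) = y i * y j.
  by rewrite phiM !phiX.
clearbody phi.
have phi_rel p : weyl_rel p -> phi p = 0.
  elim=> {p} [i j neq_ij||p q _ ph _ qh|p q _ qh|p q _ ph].
  - rewrite phiB; apply/eqP; rewrite subr_eq0 phiD; apply/eqP.
    rewrite [RHS]phi1 -(yy i j) //.
    exact: (congr2 +%R (phiXX i j) (phiXX j i)).
  - exact: phi0.
  - by rewrite phiD ph qh addr0.
  - by rewrite phiM qh mulr0.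
  - by rewrite phiM ph mul0r.
by move=> /phi_rel; rewrite phi1; exact/eqP/oner_neq0.
Qed.

Let piP (P : W -> Prop) : (forall p, P (\pi_W p)) -> forall a, P a.
Proof. by move=> piP a; rewrite -[a]reprK. Qed.

Fact qweyl_mulA : associative qweyl_mul.
Proof.
by elim/piP=> p; elim/piP=> q; elim/piP=> r; rewrite !pi_qweylM mulrA.
Qed.

Fact qweyl_mul1w : left_id (qweyl_one) qweyl_mul.
Proof. by elim/piP=> p; rewrite -pi_qweyl_one pi_qweylM mul1r. Qed.

Fact qweyl_mulw1 : right_id (qweyl_one) qweyl_mul.
Proof. by elim/piP=> p; rewrite -pi_qweyl_one pi_qweylM mulr1. Qed.

Fact qweyl_mulDl : left_distributive qweyl_mul +%R.
Proof.
elim/piP=> p; elim/piP=> q; elim/piP=> r.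
by rewrite -pi_qweylD !pi_qweylM -pi_qweylD mulrDl.
Qed.

Fact qweyl_mulDr : right_distributive qweyl_mul +%R.
Proof.
elim/piP=> p; elim/piP=> q; elim/piP=> r.
by rewrite -pi_qweylD !pi_qweylM -pi_qweylD mulrDr.
Qed.

Fact qweyl_one_neq0 : qweyl_one != 0.
Proof.
apply/negP; rewrite -pi_qweyl0 -pi_qweyl_one.
by move=> /qweyl_eqP; rewrite subr0; exact: weyl_rel_proper.
Qed.

HB.instance Definition _ := GRing.Zmodule_isNzRing.Build W
  qweyl_mulA qweyl_mul1w qweyl_mulw1 qweyl_mulDl qweyl_mulDr qweyl_one_neq0.

Fact qweyl_scaleA c d (a : W) :
  qweyl_scale c (qweyl_scale d a) = qweyl_scale (c * d) a.
Proof. by elim/piP: a => p; rewrite !pi_qweylZ scalerA. Qed.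

Fact qweyl_scale1 : left_id 1 qweyl_scale.
Proof. by elim/piP=> p; rewrite pi_qweylZ scale1r. Qed.

Fact qweyl_scaleDr : right_distributive qweyl_scale +%R.
Proof.
move=> c; elim/piP=> p; elim/piP=> q.
by rewrite -pi_qweylD !pi_qweylZ -pi_qweylD scalerDr.
Qed.

Fact qweyl_scaleDl (a : W) :
  {morph qweyl_scale^~ a : c d / c + d}.
Proof.
by move=> c d; elim/piP: a => p; rewrite !pi_qweylZ -pi_qweylD scalerDl.
Qed.

HB.instance Definition _ := GRing.Zmodule_isLmodule.Build k W
  qweyl_scaleA qweyl_scale1 qweyl_scaleDr qweyl_scaleDl.

Lemma pi_qweyl1 : \pi_W 1 = 1.
Proof. exact: pi_qweyl_one. Qed.

Lemma pi_qweyl_mul p q : \pi_W (p * q) = \pi_W p * \pi_W q.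
Proof. by rewrite -pi_qweylM. Qed.

Lemma pi_qweyl_scale c p : \pi_W (c *: p) = c *: \pi_W p.
Proof. by rewrite -pi_qweylZ. Qed.

Fact qweyl_scalerAl c (a b : W) : c *: (a * b) = (c *: a) * b.
Proof.
elim/piP: a => p; elim/piP: b => q.
by rewrite -pi_qweyl_mul -!pi_qweyl_scale -pi_qweyl_mul scalerAl.
Qed.

HB.instance Definition _ := GRing.Lmodule_isLalgebra.Build k W qweyl_scalerAl.

Fact qweyl_scalerAr c (a b : W) : c *: (a * b) = a * (c *: b).
Proof.
elim/piP: a => p; elim/piP: b => q.
by rewrite -pi_qweyl_mul -!pi_qweyl_scale -pi_qweyl_mul malg_scalerAr.
Qed.

HB.instance Definition _ := GRing.Lalgebra_isAlgebra.Build k W qweyl_scalerAr.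

Definition qweyl_gen (i : 'I_n) : W := \pi_W (free_gen i).

Local Notation x := qweyl_gen.

Lemma qweyl_genP (i j : 'I_n) : i != j -> x i * x j + x j * x i = 1.
Proof.
move=> neq_ij; rewrite -!pi_qweyl_mul -pi_qweylD.
by rewrite -pi_qweyl1; apply/eqP/qweyl_eqP; exact: weyl_rel_gen.
Qed.

Lemma qweyl_ind (P : W -> Prop) :
  (forall i, P (x i)) -> (forall c : k, P c%:A) ->
  (forall a b, P a -> P b -> P (a + b)) ->
  (forall a b, P a -> P b -> P (a * b)) ->
  forall a, P a.
Proof.
move=> Px Pc PD PM; elim/piP=> p; rewrite [p]monalgE.
elim/big_ind: _ => [|q r|m _]; first by rewrite pi_qweyl0 -(scale0r 1).
  by rewrite pi_qweylD; exact: PD.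
have -> : << p@_m *g m >> = p@_m *: << m >> :> free_alg.
  by rewrite -mul_malgC [RHS]fgmulUU mulr1 mul1m.
rewrite pi_qweyl_scale -[\pi_W _]mul1r scalerAl; apply: (PM) => //.
case: m => s; elim: s => [|i s IHs]; first by rewrite -fmoneE pi_qweyl1 -[1]scale1r.
rewrite (_ : << _ >> = free_gen i * << FMonom s >>); last first.
  rewrite [RHS]fgmulUU mulr1; congr << _ >>.
  by apply/val_inj; rewrite /= fmM fmU.
by rewrite pi_qweyl_mul; apply: (PM) => //; exact: Px.
Qed.

Definition qweyl_sqr (a : W) : Prop := exists i : 'I_n, a = x i ^+ 2.

Definition qweyl_Zpred : {pred W} := gen_subalg qweyl_sqr.
HB.instance Definition _ :=
  GRing.SubalgClosed.copy qweyl_Zpred (gen_subalg qweyl_sqr).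

Lemma qweyl_sqr_comm i j : x i ^+ 2 * x j = x j * x i ^+ 2.
Proof.
have [->|neq_ij] := eqVneq i j; first by rewrite -exprSr -exprS.
have xij : x i * x j = 1 - x j * x i by rewrite -(qweyl_genP neq_ij) addrK.
rewrite !expr2 -[LHS]mulrA xij mulrBr mulr1 [x i * (x j * x i)]mulrA xij.
by rewrite mulrBl mul1r opprB addrC subrK mulrA.
Qed.

Lemma qweyl_Z_central (a b : W) : a \in qweyl_Zpred -> a * b = b * a.
Proof.
move=> /asboolP; elim=> {a} [a [i ->]|c|a a' _ IHa _ IHa'|a a' _ IHa _ IHa'].
- elim/qweyl_ind: b => [j|c|b b' hb hb'|b b' hb hb'].
  + exact: qweyl_sqr_comm.
  + by rewrite -scalerAr -scalerAl mulr1 mul1r.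
  + by rewrite mulrDl mulrDr hb hb'.
  + by rewrite mulrA hb -mulrA hb' mulrA.
- by rewrite -scalerAr -scalerAl mulr1 mul1r.
- by rewrite mulrDl mulrDr IHa IHa'.
- by rewrite -mulrA IHa' mulrA IHa mulrA.
Qed.

Record qweyl_Z : predArgType :=
  QWeylZ { qweyl_Zval : W; _ : qweyl_Zval \in qweyl_Zpred }.

HB.instance Definition _ := [isSub for qweyl_Zval].
HB.instance Definition _ := [Choice of qweyl_Z by <:].
HB.instance Definition _ := [SubChoice_isSubAlgebra of qweyl_Z by <:].

Fact qweyl_Z_mulC : commutative (@GRing.mul qweyl_Z).
Proof.
by move=> a b; apply/val_inj; rewrite !rmorphM; exact/qweyl_Z_central/valP.
Qed.

HB.instance Definition _ :=
  GRing.PzRing_hasCommutativeMul.Build qweyl_Z qweyl_Z_mulC.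

Fact qweyl_sqr_in_Z i : x i ^+ 2 \in qweyl_Zpred.
Proof. by apply/asboolP/generated_gen; exists i. Qed.

Definition qweyl_Zsqr (i : 'I_n) : qweyl_Z := QWeylZ (qweyl_sqr_in_Z i).

Definition qweyl_mx : 'M[qweyl_Z]_n :=
  \matrix_(i, j) if i == j then 2%:R * qweyl_Zsqr i else 1.

Definition qweyl_incl : {rmorphism qweyl_Z -> W} := \val.

(* x_1^{d_1} ... x_n^{d_n}, in this order, with d_i = 1 exactly for i in D *)
Definition qweyl_monomial (D : {set 'I_n}) : W :=
  \prod_(i < n) x i ^+ (i \in D).

Definition qweyl_monomials (m : 'I_#|{set 'I_n}|) : W :=
  qweyl_monomial (enum_val m).

End QuantumWeyl.

Arguments qweyl_incl k n : clear implicits.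
Arguments qweyl_mx k n : clear implicits.
Arguments qweyl_monomials k n m : clear implicits.

(* Main.v *)
From HB Require Import structures.
Require Import Defs.
From mathcomp Require Import all_boot all_order all_algebra.
From mathcomp Require Import ring.
From mathcomp Require boolp classical_sets.
From mathcomp Require Import monalg mpoly.

Set Implicit Arguments.
Unset Strict Implicit.
Unset Printing Implicit Defensive.

Import GRing.Theory.
Local Open Scope ring_scope.

(* W_n acts by left multiplication on the free module over R = k[t_1, ..., t_n]
   spanned by the monomials; this is the fermionic Fock representation of
   Defs.v with t_i filled in, built by doubling the dimension with each new
   generator. It makes the monomials independent and identifies Z with R, whose
   units are the units of k, so any basis may be used to compute the
   discriminant up to k^x.
   The Gram determinant of the trace form is computed by induction on the
   number m of generators. Let M_m be the matrix M for x_1, ..., x_m, let D_m be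
   its determinant, and let y be D_m x_(m+1) minus the combination of
   x_1, ..., x_m with coefficients adj(M_m) (1, ..., 1)^T. Then y anticommutes
   with x_1, ..., x_m and 2 y^2 = D_m D_(m+1). The span of the old monomials is
   orthogonal to its product with y, so, writing G_m for the Gram determinant
   and N = 2^m, D_m^N G_(m+1) = +- 2^N D_(m+1)^N G_m^2. Since D_m is a nonzero
   element of the domain R, this determines G_(m+1). *)

Fixpoint dim (m : nat) : nat := if m is m'.+1 then (dim m' + dim m')%N else 1.

Lemma dimE m : dim m = (2 ^ m)%N.
Proof. by elim: m => //= m ->; rewrite addnn expnS mul2n. Qed.

Fixpoint vac (m : nat) : 'I_(dim m) :=
  if m is m'.+1 then lshift (dim m') (vac m') else ord0.

(* The generators occurring in the j-th monomial; they are numbered from 0. *)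
Fixpoint digits (m : nat) : 'I_(dim m) -> pred nat :=
  if m is m'.+1 then fun j => match split j with
    | inl l => digits l
    | inr l => predU1 m' (digits l)
    end
  else fun=> pred0.

Fixpoint mono (A : pzRingType) (x : nat -> A) (m : nat) : 'I_(dim m) -> A :=
  if m is m'.+1 then fun j => match split j with
    | inl l => mono x l
    | inr l => mono x l * x m'
    end
  else fun=> 1.

Section Digits.
Variable m : nat.

Lemma digits_lshift (j : 'I_(dim m)) i :
  @digits m.+1 (lshift (dim m) j) i = digits j i.
Proof. by rewrite /= (unsplitK (inl j)). Qed.

Lemma digits_rshift (j : 'I_(dim m)) i :
  @digits m.+1 (rshift (dim m) j) i = (i == m) || digits j i.
Proof. by rewrite /= (unsplitK (inr j)). Qed.

Lemma mono_lshift (A : pzRingType) (x : nat -> A) (j : 'I_(dim m)) :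
  @mono A x m.+1 (lshift (dim m) j) = mono x j.
Proof. by rewrite /= (unsplitK (inl j)). Qed.

Lemma mono_rshift (A : pzRingType) (x : nat -> A) (j : 'I_(dim m)) :
  @mono A x m.+1 (rshift (dim m) j) = mono x j * x m.
Proof. by rewrite /= (unsplitK (inr j)). Qed.

End Digits.

Arguments digits : simpl never.
Arguments mono : simpl never.
Arguments dim : simpl never.

Variant dim_spec m : 'I_(dim m.+1) -> Type :=
  | DimL j : dim_spec (lshift (dim m) j)
  | DimR j : dim_spec (rshift (dim m) j).

Lemma dimP m (j : 'I_(dim m.+1)) : dim_spec j.
Proof. by rewrite -[j]splitK; case: (split _) => l; constructor. Qed.

Lemma dim_ind (P : forall m, 'I_(dim m) -> Prop) :
  P 0 ord0 ->
  (forall m j, P m j -> P m.+1 (lshift (dim m) j)) ->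
  (forall m j, P m j -> P m.+1 (rshift (dim m) j)) ->
  forall m j, P m j.
Proof.
move=> P0 Pl Pr; elim=> [|m IH] j; first by rewrite [j]ord1.
by case: (dimP j) => l; [apply: Pl | apply: Pr].
Qed.

Lemma digits_lt m (j : 'I_(dim m)) i : digits j i -> (i < m)%N.
Proof.
move: m j; apply: dim_ind => // m j IH;
  first by rewrite digits_lshift => /IH/ltnW.
by rewrite digits_rshift => /orP[/eqP->//|/IH/ltnW].
Qed.

Lemma digits_inj m (j l : 'I_(dim m)) :
  (forall i, (i < m)%N -> digits j i = digits l i) -> j = l.
Proof.
elim: m j l => [|m IH] j l; first by rewrite [j]ord1 [l]ord1.
have nd (a : 'I_(dim m)) : digits a m = false.
  by apply/negP => /digits_lt; rewrite ltnn.
case: (dimP j) => j'; case: (dimP l) => l' dE.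
- congr (lshift (dim m) _); apply: IH => i /ltnW/dE.
  by rewrite !digits_lshift.
- by have := dE m (ltnSn m); rewrite digits_lshift digits_rshift eqxx nd.
- by have := dE m (ltnSn m); rewrite digits_lshift digits_rshift eqxx /= nd.
- congr (rshift (dim m) _); apply: IH => i lt_im; have := dE _ (ltnW lt_im).
  by rewrite !digits_rshift (ltn_eqF lt_im).
Qed.

Lemma monoE (A : pzRingType) (x : nat -> A) m (j : 'I_(dim m)) :
  mono x j = \prod_(i < m) x i ^+ digits j i.
Proof.
move: m j; apply: dim_ind => [|m j IH|m j IH]; first by rewrite big_ord0.
  rewrite mono_lshift big_ord_recr /= digits_lshift IH (_ : digits j m = false).
    by rewrite expr0 mulr1; apply: eq_bigr => i _; rewrite digits_lshift.
  by apply/negP => /digits_lt; rewrite ltnn.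
rewrite mono_rshift big_ord_recr /= digits_rshift eqxx IH; congr (_ * _).
by apply: eq_bigr => i _; rewrite digits_rshift (ltn_eqF (ltn_ord i)).
Qed.

(* Right multiplication by x_i, i < m, preserves the span of the monomials in
   x_0, ..., x_(m-1), because (a + b x_m) x_i = (a x_i + b) - (b x_i) x_m. *)
Section Spanning.
Variables (R A : pzRingType) (iota : {rmorphism R -> A}) (x : nat -> A).
Variable t : nat -> R.
Hypothesis iota_central : forall r a, iota r * a = a * iota r.

Definition in_span m (a : A) :=
  exists c : 'I_(dim m) -> R, a = \sum_j iota (c j) * mono x j.

Lemma in_span0 a : in_span 0 a <-> exists r, a = iota r.
Proof.
split=> [[c ->]|[r ->]]; first by exists (c ord0); rewrite big_ord1 mulr1.
by exists (fun=> r); rewrite big_ord1 mulr1.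
Qed.

Lemma in_spanS m a : in_span m.+1 a <->
  exists b c, [/\ in_span m b, in_span m c & a = b + c * x m].
Proof.
split=> [[c ->]|[b [c [[f ->] [g ->] ->]]]].
  rewrite big_split_ord /=.
  exists (\sum_j iota (c (lshift (dim m) j)) * mono x j).
  exists (\sum_j iota (c (rshift (dim m) j)) * mono x j).
  split; [by eexists|by eexists|].
  congr (_ + _); first by apply: eq_bigr => j _; rewrite (@mono_lshift m).
  by rewrite mulr_suml; apply: eq_bigr => j _; rewrite (@mono_rshift m) mulrA.
exists (fun j => match split j with inl l => f l | inr l => g l end).
rewrite big_split_ord; congr (_ + _).
  by apply: eq_bigr => j _; rewrite (@mono_lshift m) (unsplitK (inl j)).
rewrite mulr_suml; apply: eq_bigr => j _.
by rewrite (@mono_rshift m) (unsplitK (inr j)) mulrA.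
Qed.

Lemma in_spanD m a b : in_span m a -> in_span m b -> in_span m (a + b).
Proof.
move=> [f ->] [g ->]; exists (fun j => f j + g j).
by rewrite -big_split; apply: eq_bigr => j _; rewrite rmorphD mulrDl.
Qed.

Lemma in_spanZ m r a : in_span m a -> in_span m (iota r * a).
Proof.
move=> [f ->]; exists (fun j => r * f j).
by rewrite mulr_sumr; apply: eq_bigr => j _; rewrite rmorphM mulrA.
Qed.

Lemma in_span_sum m (I : finType) (F : I -> A) :
  (forall i, in_span m (F i)) -> in_span m (\sum_i F i).
Proof.
move=> FP; elim/big_rec: _ => [|i a _ spa]; last exact: in_spanD.
by exists (fun=> 0); rewrite big1 // => j _; rewrite rmorph0 mul0r.
Qed.

Lemma in_span1 m : in_span m 1.
Proof.
elim: m => [|m IH]; first by apply/in_span0; exists 1; rewrite rmorph1.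
apply/in_spanS; exists 1, 0; split; rewrite ?mul0r ?addr0 //.
by rewrite -(mul0r 1) -(rmorph0 iota); exact: in_spanZ.
Qed.

Lemma in_span_mono m (j : 'I_(dim m)) : in_span m (mono x j).
Proof.
exists (fun l => (l == j)%:R); rewrite (bigD1 j) //= eqxx rmorph1 mul1r.
by rewrite big1 ?addr0 // => l /negPf->; rewrite rmorph0 mul0r.
Qed.

Lemma in_span_mulr m a i :
  (forall i j, (i < m)%N -> (j < m)%N -> i != j -> x i * x j + x j * x i = 1) ->
  (forall i, (i < m)%N -> x i * x i = iota (t i)) ->
  (i < m)%N -> in_span m a -> in_span m (a * x i).
Proof.
elim: m a i => [|m IH] a i // xx x2 lt_im /in_spanS[b [c [spb spc ->]]].
apply/in_spanS; move: lt_im; rewrite ltnS leq_eqVlt => /predU1P[->|lt_im].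
  exists (iota (t m) * c), b; split=> //; first exact: in_spanZ.
  by rewrite mulrDl -mulrA x2 // iota_central addrC.
have IHx d : in_span m d -> in_span m (d * x i).
  apply: IH => // [j l|j] lt_jm; last exact/x2/ltnW.
  by move=> lt_lm; apply: xx; exact: ltnW.
exists (b * x i + c), (iota (-1) * (c * x i)); split.
- by apply: in_spanD => //; exact: IHx.
- by apply: in_spanZ; exact: IHx.
have xmi : x m * x i = 1 - x i * x m.
  by rewrite -(xx m i) ?gtn_eqF ?addrK // ltnW.
rewrite mulrDl -(mulrA c) xmi mulrBr mulr1 rmorphN1 mulN1r mulNr !mulrA.
by rewrite addrA.
Qed.

End Spanning.

Lemma mono_map (A B : pzRingType) (f : A -> B) (x : nat -> A) (y : nat -> B) m
    (j : 'I_(dim m)) : f 1 = 1 -> {morph f : a b / a * b} ->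
  (forall i, (i < m)%N -> y i = f (x i)) -> mono y j = f (mono x j).
Proof.
move=> f1 fM; move: m j; apply: dim_ind => // m j IH yE.
  by rewrite !mono_lshift IH // => i /ltnW/yE.
by rewrite !mono_rshift fM yE // IH // => i /ltnW/yE.
Qed.

Section SquareMatrices.
Variables (R : comPzRingType) (m : nat).
Implicit Types (r : R) (a b : 'M[R]_m).

Lemma sqmx_scalarE r a : r%:M * a = r *: a.
Proof. exact: mul_scalar_mx. Qed.

Lemma sqmx_scalarC r a : r%:M * a = a * r%:M.
Proof. by rewrite [RHS]scalar_mxC. Qed.

Lemma sqmx_scaleAl r a b : (r *: a) * b = r *: (a * b).
Proof. by rewrite [RHS]scalemxAl. Qed.

Lemma sqmx_scaleAr r a b : a * (r *: b) = r *: (a * b).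
Proof. by rewrite [RHS]scalemxAr. Qed.

Lemma sqmx_sign k a : (-1) ^+ k * a = ((-1) ^+ k : R) *: a.
Proof. by rewrite -sqmx_scalarE rmorphXn rmorphN1. Qed.

End SquareMatrices.

Section Representation.
Variables (R : comNzRingType) (t : nat -> R).

Section Blocks.
Variable m : nat.
Implicit Types a b c d : 'M[R]_(dim m).

Definition blk a b c d : 'M[R]_(dim m.+1) :=
  @block_mx R (dim m) (dim m) (dim m) (dim m) a b c d.
Definition dbl a := blk a 0 0 a.

Lemma blkM a b c d a' b' c' d' : blk a b c d * blk a' b' c' d' =
  blk (a * a' + b * c') (a * b' + b * d') (c * a' + d * c') (c * b' + d * d').
Proof. exact: mulmx_block. Qed.

Lemma blkD a b c d a' b' c' d' :
  blk a b c d + blk a' b' c' d' = blk (a + a') (b + b') (c + c') (d + d').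
Proof. exact: add_block_mx. Qed.

Lemma blkN a b c d : - blk a b c d = blk (- a) (- b) (- c) (- d).
Proof. exact: opp_block_mx. Qed.

Lemma blkZ r a b c d :
  r *: blk a b c d = blk (r *: a) (r *: b) (r *: c) (r *: d).
Proof. exact: scale_block_mx. Qed.

Lemma blk_scalar r : blk r%:M 0 0 r%:M = r%:M.
Proof. by apply/esym; exact: scalar_mx_block. Qed.

Lemma blk0 : blk 0 0 0 0 = 0.
Proof. exact: block_mx0. Qed.

Lemma blk1 : blk 1 0 0 1 = 1.
Proof. exact: blk_scalar. Qed.

Lemma tr_blk a b c d : \tr (blk a b c d) = \tr a + \tr d.
Proof. exact: mxtrace_block. Qed.

Lemma dbl1 : dbl 1 = 1. Proof. exact: blk1. Qed.

Lemma dblM : {morph dbl : a b / a * b}.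
Proof. by move=> a b; rewrite blkM !mulr0 !mul0r !addr0 add0r. Qed.

Lemma dblD : {morph dbl : a b / a + b}.
Proof. by move=> a b; rewrite blkD !addr0. Qed.

End Blocks.

Fixpoint grad m : 'M[R]_(dim m) :=
  if m is m'.+1 then blk (grad m') 0 0 (- grad m') else 1.

(* Anticommutes to 1 with every generator; this is what makes the relations
   between new and old generators hold in [new_gen]. *)
Fixpoint ann m : 'M[R]_(dim m) :=
  if m is m'.+1 then blk (ann m') (grad m') 0 (ann m') else 0.

Definition new_gen m : 'M[R]_(dim m.+1) :=
  blk (ann m) (t m *: grad m) (grad m) (ann m).

Fixpoint gen m (i : nat) : 'M[R]_(dim m) :=
  if m is m'.+1 then if i == m' then new_gen m' else dbl (gen m' i) else 0.

Lemma gen_new m : gen m.+1 m = new_gen m.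
Proof. by rewrite /= eqxx. Qed.

Lemma gen_old m i : (i < m)%N -> gen m.+1 i = dbl (gen m i).
Proof. by move=> lt_im; rewrite /= ltn_eqF. Qed.

Lemma mono_gen m (j : 'I_(dim m)) : mono (gen m.+1) j = dbl (mono (gen m) j).
Proof. by apply: mono_map; [exact: dbl1 | exact: dblM | exact: gen_old]. Qed.

Local Notation simpb := (mulr0, mul0r, mulr1, mul1r, addr0, add0r,
  mulrN, mulNr, opprK, subrr, addNr, oppr0).

Lemma grad2 m : grad m * grad m = 1.
Proof. by elim: m => [|m IH] /=; rewrite ?mulr1 // blkM !simpb IH blk1. Qed.

Lemma grad_ann m : grad m * ann m = - (ann m * grad m).
Proof.
elim: m => [|m IH] /=; rewrite ?simpb // !blkM blkN !simpb IH.
by rewrite grad2 opprK.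
Qed.

Lemma ann2 m : ann m * ann m = 0.
Proof.
elim: m => [|m IH] /=; rewrite ?simpb // !blkM !simpb IH.
by rewrite grad_ann subrr blk0.
Qed.

Lemma grad_gen m i : (i < m)%N -> grad m * gen m i = - (gen m i * grad m).
Proof.
elim: m => // m IH; rewrite ltnS leq_eqVlt => /predU1P[->|lt_im].
  rewrite gen_new /= /new_gen !blkM blkN !simpb grad_ann grad2.
  by rewrite !(sqmx_scaleAl, sqmx_scaleAr) !simpb grad2.
by rewrite gen_old //= !blkM blkN !simpb IH // opprK.
Qed.

Lemma ann_gen m i : (i < m)%N -> ann m * gen m i + gen m i * ann m = 1.
Proof.
elim: m => // m IH; rewrite ltnS leq_eqVlt => /predU1P[->|lt_im].
  rewrite gen_new /= /new_gen !blkM blkD !simpb ann2 !simpb.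
  rewrite !(sqmx_scaleAl, sqmx_scaleAr) !grad_ann grad2 !simpb scalerN.
  by rewrite addrA subrK subrr blk1.
rewrite gen_old //= !blkM blkD !simpb IH // grad_gen // addNr.
by rewrite blk1.
Qed.

Lemma gen2 m i : (i < m)%N -> gen m i * gen m i = (t i)%:M.
Proof.
elim: m => // m IH; rewrite ltnS leq_eqVlt => /predU1P[->|lt_im].
  rewrite gen_new /new_gen !blkM ann2.
  rewrite !(sqmx_scaleAl, sqmx_scaleAr) !grad_ann grad2 !simpb scalerN !subrr.
  by rewrite -blk_scalar -scalemx1.
by rewrite gen_old // -dblM IH // /dbl blk_scalar.
Qed.

Lemma gen_rel m i j : (i < m)%N -> (j < m)%N -> i != j ->
  gen m i * gen m j + gen m j * gen m i = 1.
Proof.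
have new_old k l : (k < l)%N ->
    new_gen l * dbl (gen l k) + dbl (gen l k) * new_gen l = 1.
  move=> lt_kl; rewrite !blkM blkD !simpb ann_gen //.
  rewrite !(sqmx_scaleAl, sqmx_scaleAr) grad_gen // scalerN !addNr.
  by rewrite blk1.
elim: m => // m IH; rewrite !ltnS (leq_eqVlt i) (leq_eqVlt j).
move=> /predU1P[->|lt_im] /predU1P[->|lt_jm]; rewrite ?eqxx // => neq_ij.
- by rewrite gen_new gen_old // new_old.
- by rewrite gen_new gen_old // addrC new_old.
- by rewrite !gen_old // -!dblM -dblD IH // dbl1.
Qed.

Lemma delta_lshift m (j : 'I_(dim m)) :
  delta_mx (lshift (dim m) j) 0 = col_mx (delta_mx j 0) 0 :> 'cV[R]_(dim m.+1).
Proof.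
apply/colP => i; case: (dimP i) => l; rewrite ?col_mxEu ?col_mxEd !mxE.
  by rewrite (inj_eq (@lshift_inj _ _)).
by rewrite eq_rlshift.
Qed.

Lemma delta_rshift m (j : 'I_(dim m)) :
  delta_mx (rshift (dim m) j) 0 = col_mx 0 (delta_mx j 0) :> 'cV[R]_(dim m.+1).
Proof.
apply/colP => i; case: (dimP i) => l; rewrite ?col_mxEu ?col_mxEd !mxE.
  by rewrite eq_lrshift.
by rewrite (inj_eq (@rshift_inj _ _)).
Qed.

Definition vacuum m : 'cV[R]_(dim m) := delta_mx (vac m) 0.

Lemma vacuumS m : vacuum m.+1 = col_mx (vacuum m) 0.
Proof. exact: delta_lshift. Qed.

Lemma mul_blk_col m (a b c d : 'M[R]_(dim m)) (u v : 'cV[R]_(dim m)) :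
  blk a b c d *m col_mx u v = col_mx (a *m u + b *m v) (c *m u + d *m v).
Proof. exact: mul_block_col. Qed.

Lemma grad_vacuum m : grad m *m vacuum m = vacuum m.
Proof.
elim: m => [|m IH]; first by rewrite mul1mx.
by rewrite vacuumS mul_blk_col IH !mulmx0 mul0mx !addr0.
Qed.

Lemma ann_vacuum m : ann m *m vacuum m = 0.
Proof.
elim: m => [|m IH]; first by rewrite mul0mx.
rewrite vacuumS mul_blk_col IH !mulmx0 mul0mx !addr0.
exact: col_mx0.
Qed.

Lemma mono_vacuum m (j : 'I_(dim m)) :
  mono (gen m) j *m vacuum m = delta_mx j 0.
Proof.
move: m j; apply: dim_ind => [|m j IH|m j IH]; first by rewrite mul1mx.
  rewrite mono_lshift mono_gen vacuumS mul_blk_col IH !mulmx0 !mul0mx !addr0.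
  by rewrite delta_lshift.
rewrite mono_rshift mono_gen gen_new -mulmxA vacuumS !mul_blk_col.
rewrite ann_vacuum grad_vacuum !mulmx0 !mul0mx !addr0 mulmx0 add0r IH.
by rewrite delta_rshift.
Qed.

(* Hence [gen] is the left regular representation in the basis of monomials. *)
Lemma mul_mono_vac m (a : 'M[R]_(dim m)) i j :
  (a * mono (gen m) j) i (vac m) = a i j.
Proof.
have colE (b : 'M[R]_(dim m)) l : (b *m delta_mx l 0 : 'cV_(dim m)) i 0 = b i l.
  rewrite mxE (bigD1 l) //= mxE !eqxx mulr1 big1 ?addr0 // => l' /negPf nl.
  by rewrite mxE nl mulr0.
by rewrite -[RHS]colE -mono_vacuum mulmxA [RHS]colE.
Qed.

Lemma span_coef m (c : 'I_(dim m) -> R) i :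
  (\sum_j (c j)%:M * mono (gen m) j) i (vac m) = c i.
Proof.
rewrite summxE (bigD1 i) //= mul_mono_vac mxE eqxx mulr1n.
rewrite big1 ?addr0 // => j ne_ji.
by rewrite mul_mono_vac mxE eq_sym (negPf ne_ji).
Qed.

End Representation.

Definition deg m (j : 'I_(dim m)) : nat := \sum_(i < m) digits j i.

Lemma deg_lshift m (j : 'I_(dim m)) : @deg m.+1 (lshift (dim m) j) = deg j.
Proof.
rewrite /deg big_ord_recr /= digits_lshift (_ : digits j m = false) ?addn0.
  by apply: eq_bigr => i _; rewrite digits_lshift.
by apply/negP => /digits_lt; rewrite ltnn.
Qed.

Lemma deg_rshift m (j : 'I_(dim m)) :
  @deg m.+1 (rshift (dim m) j) = (deg j).+1.
Proof.
rewrite /deg big_ord_recr /= digits_rshift eqxx addn1; congr _.+1.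
by apply: eq_bigr => i _; rewrite digits_rshift (ltn_eqF (ltn_ord i)).
Qed.

Lemma anticomm_mono (A : pzRingType) (x : nat -> A) (z : A) m (j : 'I_(dim m)) :
  (forall i, (i < m)%N -> z * x i = - (x i * z)) ->
  z * mono x j = (-1) ^+ deg j * (mono x j * z).
Proof.
move: m j; apply: dim_ind => [|m j IH|m j IH] zx.
- by rewrite /deg big_ord0 expr0 mul1r mulr1 mul1r.
- by rewrite mono_lshift deg_lshift IH // => i /ltnW/zx.
rewrite mono_rshift deg_rshift mulrA IH => [|i /ltnW/zx//].
by rewrite -!mulrA zx // exprS mulN1r mulNr !mulrN.
Qed.

Section BorderedDeterminant.
Variables (R : comNzRingType) (t : nat -> R).

Definition form_mx m : 'M[R]_m :=
  \matrix_(i, j) if i == j then 2%:R * t i else 1.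

Definition form_det m := \det (form_mx m).

Definition dual m : 'cV[R]_m := \adj (form_mx m) *m const_mx 1.

Definition dual_sum m : R := \sum_i dual m i 0.

Lemma form_dual m : form_mx m *m dual m = const_mx (form_det m).
Proof.
rewrite mulmxA mul_mx_adj mul_scalar_mx.
by apply/matrixP => i j; rewrite !mxE mulr1.
Qed.

Lemma form_detS m : form_det m.+1 * form_det m =
  form_det m * (2%:R * t m * form_det m - dual_sum m).
Proof.
have -> : form_det m.+1 = form_det (m + 1) by rewrite addn1.
pose L : 'M_(m + 1) := block_mx 1%:M (- dual m) 0 (form_det m)%:M.
have <- : \det L = form_det m by rewrite det_ublock det1 mul1r det_scalar1.
pose L' : 'M_(m + 1) := block_mx (form_mx m) 0 (const_mx 1)
  (2%:R * t m * form_det m - dual_sum m)%:M.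
transitivity (\det L');
  last by rewrite det_lblock det_scalar1 det_ublock det1 mul1r det_scalar1.
rewrite -det_mulmx; congr (\det _).
have -> : form_mx (m + 1) =
    block_mx (form_mx m) (const_mx 1) (const_mx 1) (2%:R * t m)%:M.
  apply/matrixP => i j; rewrite -[i]splitK -[j]splitK.
  case: (split i) => a; case: (split j) => b; rewrite /unsplit.
  - by rewrite block_mxEul !mxE (inj_eq (@lshift_inj _ _)).
  - by rewrite block_mxEur !mxE eq_lrshift.
  - by rewrite block_mxEdl !mxE eq_rlshift.
  - by rewrite block_mxEdr !mxE [a]ord1 [b]ord1 !eqxx /= addn0 mulr1n.
rewrite mulmx_block !mulmx1 !mulmx0 !addr0 !mulmxN form_dual.
congr block_mx; apply/matrixP => i j; rewrite !mxE.
  by rewrite big_ord1 !mxE [j]ord1 eqxx mulr1n mul1r addNr.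
rewrite [i]ord1 [j]ord1 !eqxx !mulr1n big_ord1 !mxE !eqxx !mulr1n addrC.
congr (_ - _); rewrite /dual_sum; apply: eq_bigr => l _.
by rewrite [const_mx 1 _ _]mxE mul1r.
Qed.

End BorderedDeterminant.

Section Gram.
Variables (R : idomainType) (t : nat -> R).
Hypothesis two_neq0 : 2%:R != 0 :> R.

Local Notation gen := (gen t).

Section Step.
Variable m : nat.

Local Notation D := (form_det t m).
Local Notation D' := (form_det t m.+1).
Local Notation S := (dual_sum t m).

Definition dual_vec : 'M[R]_(dim m) := \sum_(i < m) dual t m i 0 *: gen m i.

Lemma dual_vec_gen i : (i < m)%N ->
  dual_vec * gen m i + gen m i * dual_vec = D%:M.
Proof.
move=> lt_im; rewrite mulr_suml mulr_sumr -big_split /=.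
have /matrixP/(_ (Ordinal lt_im) 0) := form_dual t m; rewrite !mxE => <-.
rewrite raddf_sum; apply: eq_bigr => l _.
rewrite sqmx_scaleAl sqmx_scaleAr -scalerDr !mxE -val_eqE /= -sqmx_scalarE
  eq_sym.
have [->|neq] := eqVneq; last by rewrite gen_rel // mulr1 mul1r.
by rewrite gen2 // -mulr2n -rmorphMn -rmorphM /= mulrC mulr_natl.
Qed.

Lemma dual_vec2 : 2%:R *: (dual_vec * dual_vec) = (D * S)%:M.
Proof.
have -> : 2%:R *: (dual_vec * dual_vec) =
    \sum_(i < m) dual t m i 0 *: (dual_vec * gen m i + gen m i * dual_vec).
  rewrite scaler_nat mulr2n [RHS](eq_bigr (fun i : 'I_m =>
    dual_vec * (dual t m i 0 *: gen m i) + (dual t m i 0 *: gen m i) *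
      dual_vec)).
    by rewrite big_split -mulr_sumr -mulr_suml.
  by move=> i _; rewrite sqmx_scaleAl sqmx_scaleAr scalerDr.
rewrite mulr_sumr raddf_sum; apply: eq_bigr => i _.
by rewrite dual_vec_gen // -sqmx_scalarE -rmorphM mulrC.
Qed.

Definition corrected : 'M[R]_(dim m) := D *: ann R m - dual_vec.

Lemma corrected_gen i : (i < m)%N ->
  corrected * gen m i = - (gen m i * corrected).
Proof.
move=> lt_im; apply/eqP; rewrite -addr_eq0 mulrBl mulrBr addrACA.
by rewrite -opprD dual_vec_gen // sqmx_scaleAl sqmx_scaleAr -scalerDr ann_gen
  // scalemx1 subrr.
Qed.

Lemma corrected_grad : corrected * grad R m = - (grad R m * corrected).
Proof.
rewrite mulrBl mulrBr opprB sqmx_scaleAl sqmx_scaleAr grad_ann scalerN opprK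
  addrC; congr (_ + _).
rewrite mulr_suml mulr_sumr -sumrN; apply: eq_bigr => i _.
by rewrite sqmx_scaleAl sqmx_scaleAr grad_gen // scalerN.
Qed.

(* The component of x_m orthogonal to x_0, ..., x_(m-1), scaled by D to avoid
   denominators. *)
Definition orth : 'M[R]_(dim m.+1) := D *: gen m.+1 m - dbl dual_vec.

Lemma orthE :
  orth = blk corrected (D *: (t m *: grad R m)) (D *: grad R m) corrected.
Proof. by rewrite /orth gen_new blkZ blkN blkD oppr0 !addr0. Qed.

Lemma orth_old i : (i < m)%N ->
  orth * gen m.+1 i = - (gen m.+1 i * orth).
Proof.
move=> lt_im; apply/eqP; rewrite -addr_eq0 mulrBl mulrBr addrACA.
rewrite -opprD (gen_old _ lt_im) -!dblM -dblD dual_vec_gen // sqmx_scaleAl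
  sqmx_scaleAr -scalerDr.
rewrite -(gen_old _ lt_im) (gen_rel _ (ltnSn m) (leqW lt_im)) ?gtn_eqF //.
by rewrite scalemx1 /dbl blk_scalar subrr.
Qed.

Lemma new_dual_vec :
  gen m.+1 m * dbl dual_vec + dbl dual_vec * gen m.+1 m = S%:M.
Proof.
have -> : dbl dual_vec = \sum_(i < m) dual t m i 0 *: gen m.+1 i.
  rewrite /dual_vec; elim/big_rec2: _ => [|i a b _ <-]; first exact: blk0.
  by rewrite dblD gen_old // [in RHS]/dbl blkZ !scaler0.
rewrite mulr_sumr mulr_suml -big_split raddf_sum /=; apply: eq_bigr => i _.
by rewrite sqmx_scaleAl sqmx_scaleAr -scalerDr gen_rel ?scalemx1 ?gtn_eqF //
  ltnW // ltnS.
Qed.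

Lemma orth2 : 2%:R *: (orth * orth) = (D * D')%:M.
Proof.
have -> : D * D' = D * (2%:R * t m * D - S).
  by rewrite -form_detS mulrC.
have -> : orth * orth =
    (D * D) *: (gen m.+1 m * gen m.+1 m) -
    D *: (gen m.+1 m * dbl dual_vec + dbl dual_vec * gen m.+1 m) +
    dbl (dual_vec * dual_vec).
  rewrite /orth mulrBl !mulrBr !sqmx_scaleAl !sqmx_scaleAr scalerA dblM
    scalerDr.
  by rewrite opprB opprD !addrA [LHS]addrAC.
rewrite new_dual_vec gen2 // scalerDr [dbl (_ * _)]/dbl blkZ dual_vec2 scaler0
  blk_scalar.
rewrite -!sqmx_scalarE -!rmorphM -rmorphB -rmorphM -rmorphD /=; congr (_%:M).
ring.
Qed.

(* Moving [corrected] around the trace gives the sign (-1)^k, moving [grad]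
   around it gives the opposite sign. *)
Lemma tr_corrected k (a : 'M[R]_(dim m)) :
  grad R m * a = (-1) ^+ k * (a * grad R m) ->
  corrected * a = (-1) ^+ k * (a * corrected) ->
  \tr (a * corrected) = 0.
Proof.
move=> ga ca; set T := \tr _.
have T1 : T = (-1) ^+ k * T.
  by rewrite {1}/T [LHS]mxtrace_mulC [_ *m _]ca sqmx_sign mxtraceZ.
have T2 : T = - ((-1) ^+ k * T).
  rewrite {1}/T -[a * _]mul1r -(grad2 R m) -mulrA [LHS]mxtrace_mulC.
  rewrite -[_ *m _]/(_ * _ * _) mulrA ga sqmx_sign !sqmx_scaleAl mxtraceZ
    -!mulrA.
  rewrite corrected_grad mulrN (mulrA (grad R m)) grad2 mul1r mulrN.
  by rewrite [\tr _]raddfN mulrN.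
have /eqP : 2%:R * T = 0 by rewrite mulr_natl mulr2n {1}T1 {2}T2 subrr.
by rewrite mulf_eq0 (negPf two_neq0) => /eqP.
Qed.

End Step.
End Gram.

Lemma gram_change (R : comPzRingType) (A : pzRingType) (iota : R -> A)
    (T : A -> R) p q (w : 'I_p -> A) (v : 'I_q -> A) (Q : 'M[R]_(q, p)) :
  (forall r a, iota r * a = a * iota r) ->
  T 0 = 0 -> {morph T : a b / a + b} ->
  (forall r a, T (iota r * a) = r * T a) ->
  (forall j, v j = \sum_l iota (Q j l) * w l) ->
  \matrix_(j, l) T (v j * v l) =
    Q *m (\matrix_(j, l) T (w j * w l)) *m Q^T.
Proof.
move=> iotaC T0 TD TZ vE; apply/matrixP => j l; rewrite !mxE !vE mulr_suml.
rewrite (big_morph T TD T0) [RHS](eq_bigr (fun b =>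
  \sum_a Q j a * Q l b * T (w a * w b))); last first.
  move=> b _; rewrite mxE mulr_suml; apply: eq_bigr => a _.
  by rewrite !mxE mulrAC.
rewrite exchange_big; apply: eq_bigr => a _.
rewrite mulr_sumr (big_morph T TD T0); apply: eq_bigr => b _.
by rewrite mulrA -[_ * w a * _]mulrA -iotaC -!mulrA !TZ mulrA.
Qed.

Section Gram.
Variables (R : idomainType) (t : nat -> R).
Hypothesis two_neq0 : 2%:R != 0 :> R.

Local Notation gen := (gen t).
Local Notation D := (form_det t).

Definition gram m : 'M[R]_(dim m) :=
  \matrix_(j, l) \tr (mono (gen m) j * mono (gen m) l).

Lemma mono_dual_vec_expand m (j : 'I_(dim m)) : mono (gen m) j * dual_vec t m =
  \sum_l ((mono (gen m) j * dual_vec t m) l (vac m))%:M * mono (gen m) l.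
Proof.
have [c ->] : in_span (@scalar_mx R (dim m)) (gen m) m
    (mono (gen m) j * dual_vec t m).
  rewrite mulr_sumr; apply: in_span_sum => i.
  rewrite sqmx_scaleAr -sqmx_scalarE; apply: in_spanZ.
  apply: (@in_span_mulr _ _ _ _ t) => //; last exact: in_span_mono.
  - by move=> r a; rewrite sqmx_scalarC.
  - by move=> *; apply: gen_rel.
  - by move=> *; apply: gen2.
by apply: eq_bigr => l _; rewrite span_coef.
Qed.

Section Step.
Variable m : nat.

Definition orth_mono (j : 'I_(dim m.+1)) : 'M[R]_(dim m.+1) :=
  match split j with
  | inl l => dbl (mono (gen m) l)
  | inr l => dbl (mono (gen m) l) * orth t m
  end.

Definition orth_mx : 'M[R]_(dim m.+1) :=
  @block_mx R (dim m) (dim m) (dim m) (dim m) 1%:M 0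
  (- \matrix_(j, l) (mono (gen m) j * dual_vec t m) l (vac m)) (D m)%:M.

Lemma dbl_scale r (a : 'M[R]_(dim m)) : dbl (r%:M * a) = r%:M * dbl a.
Proof. by rewrite dblM [dbl _%:M]blk_scalar. Qed.

Lemma orth_monoE j :
  orth_mono j = \sum_l (orth_mx j l)%:M * mono (gen m.+1) l.
Proof.
rewrite [RHS]big_split_ord /= /orth_mono; case: (dimP j) => a.
  rewrite (unsplitK (inl a)) (bigD1 a) //= mono_lshift mono_gen.
  rewrite [orth_mx _ _]block_mxEul mxE eqxx mul1r !big1 ?addr0 // => l.
    by rewrite [orth_mx _ _]block_mxEur mxE raddf0 mul0r.
  by move=> ne_la; rewrite [orth_mx _ _]block_mxEul mxE eq_sym (negPf ne_la)
    raddf0 mul0r.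
rewrite (unsplitK (inr a)) addrC (bigD1 a) //= mono_rshift mono_gen.
rewrite [orth_mx _ _]block_mxEdr mxE eqxx mulr1n big1 ?addr0 => [|l ne_la];
  last first.
  by rewrite [orth_mx _ _]block_mxEdr mxE eq_sym (negPf ne_la) raddf0 mul0r.
rewrite mulrBr -dblM -sqmx_scalarE mulrA -sqmx_scalarC -mulrA.
congr (_ + _); rewrite mono_dual_vec_expand.
rewrite (big_morph _ (@dblD _ _) (blk0 _ _)) -sumrN; apply: eq_bigr => l _.
rewrite mono_lshift mono_gen [orth_mx _ _]block_mxEdl !mxE rmorphN mulNr.
by rewrite dbl_scale.
Qed.

Lemma orth_gram :
  \matrix_(j, l) \tr (orth_mono j * orth_mono l) =
    orth_mx *m gram m.+1 *m orth_mx^T.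
Proof.
apply: (gram_change (iota := @scalar_mx R (dim m.+1))
  (T := @mxtrace R (dim m.+1))).
- by move=> r a; rewrite sqmx_scalarC.
- exact: mxtrace0.
- exact: mxtraceD.
- by move=> r a; rewrite sqmx_scalarE mxtraceZ.
- exact: orth_monoE.
Qed.

Lemma grad_mono (j : 'I_(dim m)) :
  grad R m * mono (gen m) j = (-1) ^+ deg j * (mono (gen m) j * grad R m).
Proof. by apply: anticomm_mono => i; exact: grad_gen. Qed.

Lemma orth_mono_comm (j : 'I_(dim m)) :
  orth t m * dbl (mono (gen m) j) =
  (-1) ^+ deg j * (dbl (mono (gen m) j) * orth t m).
Proof. by rewrite -mono_gen; apply: anticomm_mono => i; exact: orth_old. Qed.

Lemma tr_orth (j l : 'I_(dim m)) :
  \tr (dbl (mono (gen m) j) * dbl (mono (gen m) l) * orth t m) = 0.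
Proof.
rewrite -dblM orthE blkM !mul0r !add0r !addr0 tr_blk.
have comm2 (z : 'M[R]_(dim m)) :
    (forall j : 'I_(dim m),
      z * mono (gen m) j = (-1) ^+ deg j * (mono (gen m) j * z)) ->
    z * (mono (gen m) j * mono (gen m) l) =
    (-1) ^+ (deg j + deg l) * (mono (gen m) j * mono (gen m) l * z).
  move=> zw; rewrite mulrA zw -!mulrA zw exprD -mulrA; congr (_ * _).
  by rewrite [LHS]mulrA commr_sign -!mulrA.
rewrite (@tr_corrected _ t _ _ (deg j + deg l)) ?addr0 //; apply: comm2 => l'.
  exact: grad_mono.
by apply: anticomm_mono => i; exact: corrected_gen.
Qed.

Lemma orth_gram_block :
  \matrix_(j, l) \tr (orth_mono j * orth_mono l) =
  @block_mx R (dim m) (dim m) (dim m) (dim m) (2%:R *: gram m) 0 0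
    ((D m * D m.+1) *: (gram m *m diag_mx (\row_l (-1) ^+ deg l))).
Proof.
apply/matrixP => j l; rewrite mxE /orth_mono.
case: (dimP j) => a; case: (dimP l) => b;
  rewrite ?(unsplitK (inl _)) ?(unsplitK (inr _)).
- rewrite [RHS]block_mxEul !mxE -dblM tr_blk.
  by rewrite mulr_natl mulr2n.
- by rewrite [RHS]block_mxEur mxE mulrA tr_orth.
- rewrite [RHS]block_mxEdl mxE -mulrA orth_mono_comm.
  by rewrite sqmx_sign sqmx_scaleAr mxtraceZ mulrA tr_orth mulr0.
rewrite [RHS]block_mxEdr mxE mul_mx_diag !mxE.
rewrite -[dbl _ * orth t m * _]mulrA (mulrA (orth t m)) orth_mono_comm
  sqmx_sign sqmx_scaleAl.
rewrite sqmx_scaleAr mxtraceZ [RHS]mulrA [RHS]mulrC; congr (_ * _).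
apply: (mulfI two_neq0);
  rewrite -[LHS]mxtraceZ -sqmx_scaleAr -[dbl _ * orth t m * _]mulrA
    -sqmx_scaleAr.
rewrite orth2 mulrA -sqmx_scalarC sqmx_scalarE mxtraceZ -dblM tr_blk.
by rewrite mulrCA mulr_natl mulr2n.
Qed.

Lemma gram_detS :
  D m ^+ dim m * \det (gram m.+1) * D m ^+ dim m =
  D m ^+ dim m * ((-1) ^+ (\sum_(l < dim m) deg l) * 2%:R ^+ dim m *
    D m.+1 ^+ dim m * \det (gram m) ^+ 2).
Proof.
have det_orth : \det orth_mx = D m ^+ dim m.
  by rewrite [LHS]det_lblock det1 mul1r det_scalar.
rewrite -{1}det_orth -[X in _ * X = _]det_orth -[X in _ * X = _]det_tr
  -!det_mulmx.
rewrite -orth_gram orth_gram_block [LHS]det_ublock !detZ det_mulmx det_diag.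
rewrite (eq_bigr (fun l : 'I_(dim m) => (-1) ^+ deg l)) => [|l _];
  last by rewrite !mxE.
rewrite prodrXr exprMn; ring.
Qed.

End Step.

Lemma gram_det m : (forall i, (i < m)%N -> D i != 0) ->
  exists e b, \det (gram m) = (-1) ^+ e * 2%:R ^+ b * D m ^+ (2 ^ m.-1).
Proof.
elim: m => [|m IH] nzD.
  exists 0%N, 0%N; rewrite [D 0]det_mx00.
  by rewrite [gram 0]mx11_scalar det_scalar1 mxE mulr1 mxtrace1 expr1n !mulr1.
have [|e [b Gm]] := IH; first by move=> i /ltnW/nzD.
exists (\sum_(l < dim m) deg l + e * 2)%N, (dim m + b * 2)%N.
have nzX : D m ^+ dim m != 0 by rewrite expf_neq0 ?nzD.
apply: (mulfI nzX); apply: (mulIf nzX);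
  rewrite gram_detS Gm [m.+1.-1]/= -(dimE m).
have <- : D m ^+ (2 ^ m.-1 * 2) = D m ^+ dim m.
  rewrite dimE; case: (m) => [|m'] /=; last by rewrite expnSr.
  by rewrite [D 0]det_mx00 !expr1n.
rewrite !exprD !exprM; ring.
Qed.

End Gram.

Section BasisChange.
Variables (Z : comNzRingType) (A : nzRingType) (iota : {rmorphism Z -> A}).
Hypothesis iota_central : forall c a, iota c * a = a * iota c.

Section Coordinates.
Variables (r : nat) (z : 'I_r -> A).
Hypothesis zP : is_basis iota z.

Lemma coordinatesK a : lincomb iota z (coordinates iota z a) = a.
Proof.
have [c [cP _]] := zP a.
exact: (classical_sets.xgetPex 0 (ex_intro (fun c => lincomb iota z c = a) c
  cP)).
Qed.

Lemma lincombK c : coordinates iota z (lincomb iota z c) = c.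
Proof.
have [c' [_ c'U]] := zP (lincomb iota z c).
exact: etrans (esym (c'U _ (coordinatesK _))) (c'U c erefl).
Qed.

Lemma lincombD c d :
  lincomb iota z (c + d) = lincomb iota z c + lincomb iota z d.
Proof.
by rewrite -big_split; apply: eq_bigr => i _; rewrite mxE rmorphD mulrDl.
Qed.

Lemma lincombZ e c : lincomb iota z (e *: c) = iota e * lincomb iota z c.
Proof. by rewrite mulr_sumr; apply: eq_bigr => i _;
  rewrite mxE rmorphM mulrA. Qed.

Lemma coordinatesD a b :
  coordinates iota z (a + b) = coordinates iota z a + coordinates iota z b.
Proof. by rewrite -[RHS]lincombK lincombD !coordinatesK. Qed.


Lemma coordinatesZ c a :
  coordinates iota z (iota c * a) = c *: coordinates iota z a.
Proof. by rewrite -[RHS]lincombK lincombZ coordinatesK. Qed.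

Lemma reg_traceD : {morph reg_trace iota z : a b / a + b}.
Proof.
move=> a b; rewrite -mxtraceD; congr (\tr _); apply/matrixP => i j.
by rewrite !mxE mulrDl coordinatesD mxE.
Qed.

Lemma reg_traceZ c a : reg_trace iota z (iota c * a) = c * reg_trace iota z a.
Proof.
rewrite -mxtraceZ; congr (\tr _); apply/matrixP => i j.
by rewrite !mxE -mulrA coordinatesZ mxE.
Qed.

Lemma reg_trace0 : reg_trace iota z 0 = 0.
Proof. by rewrite -(mul0r 0) -(rmorph0 iota) reg_traceZ mul0r. Qed.

Lemma coordinates_sum (I : finType) (F : I -> A) :
  coordinates iota z (\sum_i F i) = \sum_i coordinates iota z (F i).
Proof.
apply: (big_morph _ coordinatesD).
by rewrite -[0 in RHS](scale0r (coordinates iota z 0)) -coordinatesZ rmorph0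
  mul0r.
Qed.

End Coordinates.

Definition transition r p (z : 'I_r -> A) (w : 'I_p -> A) : 'M[Z]_(p, r) :=
  \matrix_j coordinates iota z (w j).

Section Transition.
Variables (r p : nat) (z : 'I_r -> A) (w : 'I_p -> A).
Hypotheses (zP : is_basis iota z) (wP : is_basis iota w).

Lemma transitionE j : w j = \sum_i iota (transition z w j i) * z i.
Proof.
by rewrite -[LHS](coordinatesK zP); apply: eq_bigr => i _; rewrite !mxE.
Qed.

Lemma coordinates_transition a :
  coordinates iota z a = coordinates iota w a *m transition z w.
Proof.
rewrite -{1}[a](coordinatesK wP) coordinates_sum //.
apply/rowP => i; rewrite mxE summxE; apply: eq_bigr => j _.
by rewrite coordinatesZ // !mxE.
Qed.

End Transition.

Lemma transitionK r p (z : 'I_r -> A) (w : 'I_p -> A) :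
  is_basis iota z -> is_basis iota w -> transition z w *m transition w z = 1%:M.
Proof.
move=> zP wP; apply/row_matrixP => i; rewrite row_mul rowK.
rewrite -coordinates_transition // rowE mulmx1 -[RHS](lincombK wP).
congr coordinates; rewrite /lincomb (bigD1 i) //= mxE !eqxx rmorph1 mul1r.
by rewrite big1 ?addr0 // => j ne_ji;
  rewrite mxE (negPf ne_ji) andbF rmorph0 mul0r.
Qed.

Lemma reg_trace_indep r p (z : 'I_r -> A) (w : 'I_p -> A) a :
  is_basis iota z -> is_basis iota w -> reg_trace iota z a = reg_trace iota w a.
Proof.
move=> zP wP; rewrite /reg_trace -mxtrace_tr.
have -> : (lmul_mx iota z a)^T =
    transition w z *m (lmul_mx iota w a)^T *m transition z w.
  apply/row_matrixP => j; rewrite -mulmxA row_mul mulmxA -row_mul.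
  have -> : row j (lmul_mx iota z a)^T = coordinates iota z (a * z j).
    by apply/rowP => i; rewrite !mxE.
  rewrite (coordinates_transition zP wP) row_mul; congr (_ *m _).
  rewrite [in LHS](transitionE z wP j) mulr_sumr coordinates_sum //.
  apply/rowP => i; rewrite mxE summxE; apply: eq_bigr => l _.
  by rewrite mulrA -iota_central -mulrA coordinatesZ // !mxE.
by rewrite mxtrace_mulC mulmxA transitionK // mul1mx mxtrace_tr.
Qed.

Lemma discriminant_change r p (z : 'I_r -> A) (w : 'I_p -> A) :
  is_basis iota z -> is_basis iota w ->
  exists2 u, exists v, u * v = 1 &
    discriminant iota z = u ^+ 2 * discriminant iota w.
Proof.
move=> zP wP; have zw := transitionK zP wP; have wz := transitionK wP zP.
have e : r = p by apply/eqP; rewrite eqn_leq (mulmx1_min zw) (mulmx1_min wz).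
case: p / e w wP zw wz => w wP zw wz.
exists (\det (transition w z)).
  by exists (\det (transition z w)); rewrite -det_mulmx wz det1.
rewrite /discriminant (gram_change (iota := iota) (w := w) (Q := transition w
  z)) //.
- rewrite !det_mulmx det_tr mulrAC -expr2; congr (_ * \det _).
  by apply/matrixP => i j; rewrite !mxE (reg_trace_indep _ zP wP).
- exact: reg_trace0.
- exact: reg_traceD.
- exact: reg_traceZ.
- exact: transitionE.
Qed.

Lemma is_basis_reindex r p (z : 'I_r -> A) (g : 'I_p -> 'I_r) :
  bijective g -> is_basis iota (z \o g) -> is_basis iota z.
Proof.
move=> g_bij zgP a; have [h gK hK] := g_bij; have [c [cP cU]] := zgP a.
exists (\row_i c 0 (h i)); split.
  rewrite -cP /lincomb (reindex g) /=; last exact: onW_bij.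
  by apply: eq_bigr => i _; rewrite mxE gK.
move=> d dP; apply/rowP => i; rewrite mxE (cU (\row_i d 0 (g i))) ?mxE ?hK //.
rewrite -dP /lincomb [RHS](reindex g) /=; last exact: onW_bij.
by apply: eq_bigr => j _; rewrite mxE.
Qed.

End BasisChange.

Lemma qweyl_universal (k : comNzRingType) n (A : nzRingType)
    (f : {rmorphism k -> A}) (y : 'I_n -> A) :
  (forall c a, f c * a = a * f c) ->
  (forall i j, i != j -> y i * y j + y j * y i = 1) ->
  exists rho : {rmorphism qweyl k n -> A},
    (forall i, rho (qweyl_gen k i) = y i) /\ (forall c, rho c%:A = f c).
Proof.
move=> fC yy.
pose h (m : {fmonom 'I_n}) : A := \prod_(i <- (m : seq 'I_n)) y i.
have hM : mmorphism h by split=> [p q|]; rewrite /h ?fmM ?big_cat ?fm1 ?big_nil.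
pose H : {mmorphism {fmonom 'I_n} -> A} :=
  HB.pack h (isMultiplicative.Build _ _ h hM).
pose phi : {malg k[{fmonom 'I_n}]} -> A := monalg.mmap f H.
have [phi1 phiM] : monoid_morphism phi.
  have [] // := @monalg.commr_mmap_is_multiplicative _ _ _ f H.
  by move=> g m m'; exact: fC.
have phiB p q : phi (p - q) = phi p - phi q by exact: monalg.mmapB.
have phi0 : phi 0 = 0 by exact: monalg.mmap0.
have phiD p q : phi (p + q) = phi p + phi q by exact: monalg.mmapD.
have phiZ c p : phi (c *: p) = f c * phi p by exact: monalg.mmapZ.
have phiX i : phi (free_gen k i) = y i.
  by rewrite /phi monalg.mmapU /= /h fmU big_seq1 rmorph1 mul1r.
clearbody phi.
have phi_rel p : weyl_rel p -> phi p = 0.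
  elim=> {p} [i j neq_ij||p q _ ph _ qh|p q _ qh|p q _ ph].
  - by rewrite phiB phiD !phiM !phiX yy // phi1 subrr.
  - exact: phi0.
  - by rewrite phiD ph qh addr0.
  - by rewrite phiM qh mulr0.
  - by rewrite phiM ph mul0r.
pose rho (a : qweyl k n) : A := phi (generic_quotient.repr a).
have rhoE p : rho (generic_quotient.pi (qweyl k n) p) = phi p.
  by apply/eqP; rewrite -subr_eq0 -phiB phi_rel //; exact: qweyl_repr.
have piP (a : qweyl k n) : exists p, a = generic_quotient.pi (qweyl k n) p.
  by exists (generic_quotient.repr a); rewrite generic_quotient.reprK.
have rhoB : zmod_morphism rho.
  move=> a b; have [p ->] := piP a; have [q ->] := piP b.
  by rewrite -raddfB !rhoE phiB.
have rhoM : monoid_morphism rho.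
  split=> [|a b]; first by rewrite -pi_qweyl1 rhoE.
  have [p ->] := piP a; have [q ->] := piP b.
  by rewrite -pi_qweyl_mul !rhoE phiM.
pose rhoR : {rmorphism qweyl k n -> A} :=
  HB.pack rho (GRing.isZmodMorphism.Build _ _ rho rhoB)
    (GRing.isMonoidMorphism.Build _ _ rho rhoM).
exists rhoR; split=> [i|c]; first by rewrite /= rhoE.
by rewrite /= -pi_qweyl1 -pi_qweyl_scale rhoE phiZ phi1 mulr1.
Qed.

Lemma qweyl_mx_rep (k R : comNzRingType) n N (f : {rmorphism k -> R})
    (y : 'I_n -> 'M[R]_N) :
  (0 < N)%N -> (forall i j, i != j -> y i * y j + y j * y i = 1) ->
  exists rho : {rmorphism qweyl k n -> 'M[R]_N},
    (forall i, rho (qweyl_gen k i) = y i) /\ (forall c, rho c%:A = (f c)%:M).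
Proof.
case: N y => // N y _ yy.
have [|rho rhoP] := @qweyl_universal k n 'M[R]_N.+1 (@scalar_mx R N.+1 \o f) y
  _ yy.
  by move=> c a; exact: sqmx_scalarC.
by exists rho.
Qed.

(* A specialization at which all the leading principal minors of M equal 1, so
   that they do not vanish in k[t_1, ..., t_n], whatever the characteristic. *)
Lemma form_det_special (R : comNzRingType) (t : nat -> R) m :
  2%:R * t 0%N = 1 -> (forall i, (0 < i < m)%N -> t i = 1) -> form_det t m = 1.
Proof.
case: m => [|m] t0 t1; first by rewrite /form_det det_mx00.
have -> : form_det t m.+1 =
    \det (block_mx 1%:M 0 (const_mx 1) 1%:M *m block_mx 1%:M (const_mx 1) 0
      1%:M : 'M[R]_(1 + m)).
  rewrite mulmx_block !mulmx1 !mulmx0 !mul1mx !addr0.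
  congr (\det _); apply/matrixP => i j;
    rewrite -[i](@splitK 1 m) -[j](@splitK 1 m).
  case: (split _) => a; case: (split _) => b; rewrite /unsplit.
  - by rewrite [RHS]block_mxEul !mxE [a]ord1 [b]ord1 !eqxx t0.
  - by rewrite [RHS]block_mxEur !mxE -val_eqE [a]ord1.
  - by rewrite [RHS]block_mxEdl !mxE -val_eqE [b]ord1.
  - rewrite [RHS]block_mxEdr !mxE big_ord1 !mxE mulr1 -val_eqE /= eqSS val_eqE.
    by case: eqP => _; rewrite ?addr0 // t1 ?mulr1 //= add1n ltnS.
by rewrite det_mulmx det_lblock det_ublock !det1 !mulr1.
Qed.

Lemma card_dim n : #|{set 'I_n}| = dim n.
Proof. by rewrite -cardsT -powersetT card_powerset cardsT card_ord dimE. Qed.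

Section Weyl.
Variables (k : idomainType) (n' : nat).
Hypothesis two_unit : (2%:R : k) \is a GRing.unit.

Local Notation n := n'.+1.
Local Notation W := (qweyl k n).
Local Notation Z := (qweyl_Z k n).
Local Notation iota := (qweyl_incl k n).
Local Notation P := {mpoly k[n]}.

Definition wgen (i : nat) : W := qweyl_gen k (inord i).
Definition wsqr (i : nat) : Z := qweyl_Zsqr k (inord i).
Definition pvar (i : nat) : P := 'X_(inord i).

Local Notation w := (@mono W wgen n).

Lemma iota_central (c : Z) (a : W) : iota c * a = a * iota c.
Proof. exact/qweyl_Z_central/valP. Qed.

Lemma incl_alg (c : k) : iota c%:A = c%:A.
Proof. by []. Qed.

Lemma inord_neq i j : (i < n)%N -> (j < n)%N -> i != j ->
  inord i != inord j :> 'I_n.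
Proof. by move=> lt_in lt_jn; rewrite -val_eqE /= !inordK. Qed.

Lemma qweyl_span (a : W) : in_span iota wgen n a.
Proof.
suff mulP b : in_span iota wgen n b -> in_span iota wgen n (b * a).
  by rewrite -[a]mul1r; exact/mulP/in_span1.
elim/qweyl_ind: a b => [i|c|a a' IH IH'|a a' IH IH'] b bP.
- rewrite -(inord_val i); apply: (in_span_mulr (t := wsqr) iota_central) => //.
  by move=> j l lt_jn lt_ln neq_jl; apply: qweyl_genP; exact: inord_neq.
- rewrite (_ : b * _ = iota (c%:A : Z) * b); first exact: in_spanZ.
  by rewrite incl_alg -scalerAl -scalerAr mul1r mulr1.
- by rewrite mulrDr; apply: in_spanD; [exact: IH | exact: IH'].
- by rewrite mulrA; apply/IH'/IH.
Qed.

Lemma pvar_rep : exists (rho : {rmorphism W -> 'M[P]_(dim n)})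
    (phi : {rmorphism Z -> P}),
  [/\ forall i, (i < n)%N -> rho (wgen i) = gen pvar n i,
      forall c, rho (iota c) = (phi c)%:M,
      injective phi,
      forall c : k, phi c%:A = c%:MP
    & forall i, (i < n)%N -> phi (wsqr i) = pvar i].
Proof.
have dim_gt0 : (0 < dim n)%N by rewrite dimE expn_gt0.
have [|rho [rhoX rhoC]] := @qweyl_mx_rep k P n _ (@mpolyC n k)
  (fun i : 'I_n => gen pvar n i) dim_gt0.
  by move=> i j neq_ij; apply: gen_rel.
pose psi : {rmorphism P -> Z} := mmap (GRing.in_alg Z) (@qweyl_Zsqr k n).
have psiC c : psi c%:MP = c%:A by rewrite /psi /= mmapC.
have psiX i : psi 'X_i = qweyl_Zsqr k i by rewrite /psi /= mmapX mmap1U.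
have scalar_inj : injective (@scalar_mx P (dim n)).
  by move=> p q /matrixP/(_ (vac n) (vac n)); rewrite !mxE eqxx.
have rhoZ (c : Z) : exists p, rho (iota c) = p%:M /\ psi p = c.
  suff gen_P a : generated (qweyl_sqr (n:=n)) a ->
      exists p, rho a = p%:M /\ iota (psi p) = a.
    have /gen_P[p [rp pp]] : generated (qweyl_sqr (n:=n)) (iota c).
      by apply/boolp.asboolP; exact: valP c.
    by exists p; split=> //; exact: val_inj.
  elim=> {a} [b [i ->]|d|b b' _ [p [rp pp]] _ [q [rq pq]]|
    b b' _ [p [rp pp]] _ [q [rq pq]]].
  - exists 'X_i; rewrite psiX; split=> //.
    by rewrite rmorphXn /= rhoX expr2 gen2 // /pvar inord_val.
  - by exists d%:MP; rewrite psiC rhoC.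
  - by exists (p + q); rewrite !rmorphD rp rq pp pq.
  - by exists (p * q); rewrite !rmorphM rp rq pp pq.
pose phi (c : Z) : P := rho (iota c) (vac n) (vac n).
have rho_phi c : rho (iota c) = (phi c)%:M.
  by have [p [rp _]] := rhoZ c; rewrite /phi rp mxE eqxx.
have psi_phi c : psi (phi c) = c.
  have [p [rp pp]] := rhoZ c; suff -> : phi c = p by [].
  by apply: scalar_inj; rewrite -rho_phi.
have phiB : zmod_morphism phi.
  by move=> a b; apply: scalar_inj; rewrite -rho_phi !rmorphB /= !rho_phi.
have phiM : monoid_morphism phi.
  split=> [|a b]; apply: scalar_inj; first by rewrite -rho_phi !rmorph1.
  by rewrite -rho_phi !rmorphM /= !rho_phi.
pose phiR : {rmorphism Z -> P} :=
  HB.pack phi (GRing.isZmodMorphism.Build _ _ phi phiB)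
    (GRing.isMonoidMorphism.Build _ _ phi phiM).
exists rho, phiR; split=> [i lt_in|c||c|i lt_in] /=.
- by rewrite rhoX inordK.
- exact: rho_phi.
- exact: can_inj psi_phi.
- by apply: scalar_inj; rewrite -rho_phi -rhoC incl_alg.
- apply: scalar_inj; rewrite -rho_phi -(gen2 pvar lt_in) /wsqr /=.
  by rewrite expr2 rmorphM /= rhoX inordK.
Qed.

Lemma unit_const (u v : Z) : u * v = 1 ->
  exists2 c : k, c \is a GRing.unit & u = c%:A.
Proof.
move=> uv1; have [_ [phi [_ _ phi_inj phiC _]]] := pvar_rep.
have /andP[/eqP pE cU] : mpoly_unit (phi u).
  by apply: (@mpoly_intro_unit _ _ _ (phi v));
    rewrite mulrC -rmorphM uv1 rmorph1.
by exists (phi u)@_0 => //; apply: phi_inj; rewrite phiC.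
Qed.

Lemma pvar_det_neq0 m : (m <= n)%N -> form_det pvar m != 0.
Proof.
move=> le_mn; pose v (i : 'I_n) : k := if i == 0%N :> nat then 2%:R^-1 else 1.
suff ev : (form_det pvar m).@[v] = 1.
  by apply: contra_eq_neq ev => ->; rewrite meval0 eq_sym oner_neq0.
rewrite /form_det -det_map_mx.
rewrite -[RHS](@form_det_special _ (fun i => (pvar i).@[v]) m).
- congr (\det _); apply/matrixP => i j; rewrite !mxE.
  by case: ifP => _; rewrite ?rmorph1 // rmorphM rmorph_nat.
- by rewrite /pvar mevalXU /v inordK // mulrV.
- move=> i /andP[i_gt0 lt_im]; rewrite /pvar mevalXU /v inordK ?gtn_eqF //.
  exact: leq_trans le_mn.
Qed.

Lemma wmono_basis : is_basis iota w.
Proof.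
have [rho [phi [rhoX rho_phi phi_inj _ _]]] := pvar_rep.
have rhow j : rho (w j) = mono (gen pvar n) j.
  by apply/esym/mono_map => [||i lt_in]; rewrite ?rmorph1 ?rhoX //;
    exact: rmorphM.
move=> a; have [c aE] := qweyl_span a; exists (\row_i c i); split.
  by rewrite aE; apply: eq_bigr => i _; rewrite mxE.
suff coef d : lincomb iota w d = a -> forall i, phi (d 0 i) = rho a i (vac n).
  move=> d dP; apply/rowP => i; apply: phi_inj; rewrite (coef d dP) coef //.
  by rewrite aE; apply: eq_bigr => l _; rewrite mxE.
move=> <- i; rewrite rmorph_sum /= -(span_coef pvar (fun l => phi (d 0 l)) i).
congr (fun_of_matrix _ _ _); apply: eq_bigr => j _.
by rewrite rmorphM /= rhow rho_phi.
Qed.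

Lemma wmono_discriminant : exists2 c : k, c \is a GRing.unit &
  discriminant iota w = c *: \det (qweyl_mx k n) ^+ (2 ^ n.-1).
Proof.
have [rho [phi [rhoX rho_phi phi_inj phiC phiX]]] := pvar_rep.
have rhow j : rho (w j) = mono (gen pvar n) j.
  by apply/esym/mono_map => [||i lt_in]; rewrite ?rmorph1 ?rhoX //;
    exact: rmorphM.
have two_neq0 : 2%:R != 0 :> P.
  rewrite -(rmorph_nat (@mpolyC n k)) mpolyC_eq0.
  by apply: contraTneq two_unit => ->; rewrite unitr0.
have phi_coord a i : phi (coordinates iota w a 0 i) = rho a i (vac n).
  rewrite -{2}(coordinatesK wmono_basis a) rmorph_sum /=.
  rewrite -(span_coef pvar (fun l => phi (coordinates iota w a 0 l)) i).
  congr (fun_of_matrix _ _ _); apply: eq_bigr => j _.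
  by rewrite rmorphM /= rhow rho_phi.
have phi_trace a : phi (reg_trace iota w a) = \tr (rho a).
  rewrite rmorph_sum; apply: eq_bigr => i _.
  by rewrite mxE phi_coord rmorphM /= rhow mul_mono_vac.
have [|e [b Ge]] := gram_det two_neq0 (t := pvar) (m := n).
  by move=> i lt_in; apply: pvar_det_neq0; exact: ltnW.
exists ((-1) ^+ e * 2%:R ^+ b).
  by rewrite unitrM !unitrX ?unitrN1.
apply: phi_inj; rewrite -det_map_mx -mulr_algl rmorphM rmorphXn phiC
  -det_map_mx.
transitivity (\det (gram pvar n)).
  congr (\det _); apply/matrixP => i j.
  by rewrite !mxE phi_trace rmorphM /= !rhow.
have -> : ((-1) ^+ e * 2%:R ^+ b : k)%:MP = (-1) ^+ e * 2%:R ^+ b :> P.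
  by rewrite mpolyCM !rmorphXn /= mpolyCN mpolyC1 mpolyC_nat.
suff <- : form_det pvar n = \det (map_mx phi (qweyl_mx k n)) by rewrite Ge.
congr (\det _); apply/matrixP => i j; rewrite [RHS]mxE [LHS]mxE.
rewrite [qweyl_mx _ _ _ _]mxE.
case: eqP => _; last by rewrite rmorph1.
rewrite rmorphM rmorph_nat -(phiX i) //; congr (_ * phi _).
by rewrite /wsqr inord_val.
Qed.

Lemma monomials_basis : is_basis iota (qweyl_monomials k n).
Proof.
pose g (j : 'I_(dim n)) := enum_rank [set i : 'I_n | digits j i].
apply: (@is_basis_reindex _ _ _ _ _ _ g).
  apply: inj_card_bij; last by rewrite !card_ord card_dim.
  move=> j l /enum_rank_inj/setP jl; apply: digits_inj => i lt_in.
  by have := jl (Ordinal lt_in); rewrite !inE.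
suff -> : qweyl_monomials k n \o g = w by exact: wmono_basis.
apply: boolp.funext => j; rewrite /= /qweyl_monomials /g enum_rankK monoE.
by apply: eq_bigr => i _; rewrite inE /wgen inord_val.
Qed.

End Weyl.

Theorem theorem0p2 (k : idomainType) (n : nat)
    (two_unit : (2%:R : k) \is a GRing.unit) (n_ge2 : (2 <= n)%N) :
  is_basis (qweyl_incl k n) (qweyl_monomials k n) /\
  forall (r : nat) (z : 'I_r -> qweyl k n),
    is_basis (qweyl_incl k n) z ->
    exists2 c : k, c \is a GRing.unit &
      discriminant (qweyl_incl k n) z
      = c *: (\det (qweyl_mx k n)) ^+ (2 ^ n.-1).
Proof.
case: n n_ge2 => // n _; split; first exact: monomials_basis.
move=> r z zP.
have [u [v uv1] ->] :=
  discriminant_change (@iota_central k n) zP (@wmono_basis k n).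
have [c cU ->] := unit_const uv1.
have [d dU ->] := wmono_discriminant n two_unit.
exists (c ^+ 2 * d); first by rewrite unitrM unitrX.
by rewrite exprZn expr1n -scalerAl mul1r scalerA.
Qed.
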